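(* For an integer $n\ge1$, $x\ge 0$ and $v>0$, let $$H_n(x,v)=\left\{\left(\frac{v^2}{x+v^2}\right)^{x+v^2}\left(\frac{n}{n-x}\right)^{n-x}\right\}^{\frac{n}{n+v^2}}\mathbf{1}_{\{x\le n\}},$$ with the convention $(+\infty)^0=1$ (which applies when $x=n$). Then, for any integer $n\ge1$, any $x\ge0$ and $v>0$, $$H_n(x,v)\le F(x,v):=\left(\frac{v^2}{x+v^2}\right)^{x+v^2}e^x,$$ $$F(x,v)\le B_1(x,v):=\exp\left\{-\frac{x^2}{v^2\left(1+\sqrt{1+\frac{2x}{3v^2}}\right)+\frac13x}\right\},$$ $$B_1(x,v)\le B_2(x,v):=\exp\left\{-\frac{x^2}{2\left(v^2+\frac13x\right)}\right\}.$$ Moreover, for any $x,v>0$, $H_n(x,v)$ is increasing in $n$ (in the wide sense, i.e. $H_n(x,v)\le H_{n+1}(x,v)$ for all $n\ge1$) and $$\lim_{n\to\infty}H_n(x,v)=F(x,v).$$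
   Context: Because of the indicator, $H_n(x,v)=0$ for $x>n$. *)

(* Defs.v *)
From Stdlib Require Import Reals.
From Coquelicot Require Import Coquelicot.
Open Scope R_scope.

(* The base [INR n / (INR n - x)] is infinite at x = n. The convention
   (+oo)^0 = 1 is met whatever value Rocq gives to [INR n / 0], because
   [Rpower b 0] = exp (0 * ln b) = 1 for every b. For x > n the value of the
   [Rpower] expression is irrelevant: it is multiplied by 0. *)
Definition Hbound (n : nat) (x v : R) : R :=
  Rpower
    (Rpower (v ^ 2 / (x + v ^ 2)) (x + v ^ 2)
     * Rpower (INR n / (INR n - x)) (INR n - x))
    (INR n / (INR n + v ^ 2))
  * (if Rle_dec x (INR n) then 1 else 0).

Definition Fbound (x v : R) : R :=
  Rpower (v ^ 2 / (x + v ^ 2)) (x + v ^ 2) * exp x.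

Definition Bound1 (x v : R) : R :=
  exp (- (x ^ 2 / (v ^ 2 * (1 + sqrt (1 + 2 * x / (3 * v ^ 2))) + 1 / 3 * x))).

Definition Bound2 (x v : R) : R :=
  exp (- (x ^ 2 / (2 * (v ^ 2 + 1 / 3 * x)))).

(* Main.v *)
Require Import Defs.
From Stdlib Require Import Reals Lra Lia.
From Coquelicot Require Import Coquelicot.
Open Scope R_scope.

(** Put [s = v^2]. For [x < t] the logarithm of [H_t(x, v)] extends to real [t],
    and [(t + s)^2] times its [t]-derivative vanishes at [x = 0] and has
    [x]-derivative [s * (y - 1 - ln y)] with [y = t (x + s) / (s (t - x))]; hence
    [H] increases in [n]. As its limit is [F], also [H <= F].
    Writing [r = sqrt (1 + 2 x / (3 s))], the exponent of [B_1] becomes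
    [- s * 9/2 * (r - 1)^2], and [F <= B_1] becomes an inequality in [r >= 1]
    that follows by differentiating twice. *)

(** * Monotonicity from the derivative, and elementary logarithm bounds *)

Lemma nonneg_derive_le (f df : R -> R) (a b : R) :
  a <= b ->
  (forall x, a <= x <= b -> is_derive f x (df x)) ->
  (forall x, a <= x <= b -> 0 <= df x) ->
  f a <= f b.
Proof.
  intros Hab Hd Hp.
  destruct (MVT_gen f a b df) as [c [Hc Heq]];
    rewrite ?Rmin_left, ?Rmax_right in * by lra.
  - intros x Hx; apply Hd; lra.
  - intros x Hx; apply continuity_pt_filterlim, (@ex_derive_continuous R_AbsRing R_NormedModule).
    exists (df x); apply Hd; lra.
  - generalize (Hp c Hc); nra.
Qed.

Lemma ln_le_sub_1 (y : R) : 0 < y -> ln y <= y - 1.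
Proof.
  intros Hy; generalize (exp_ineq1_le (ln y)); rewrite exp_ln by exact Hy; lra.
Qed.

Lemma ln_sub_le (a b : R) : 0 < a -> 0 < b -> ln a - ln b <= (a - b) / b.
Proof.
  intros Ha Hb; rewrite <- ln_div by lra.
  replace ((a - b) / b) with (a / b - 1) by (field; lra).
  apply ln_le_sub_1, Rdiv_lt_0_compat; lra.
Qed.

(** * The logarithm of [H] at a real parameter [t] *)

Definition log_Hbound (t x s : R) : R :=
  t / (t + s) * ((t - x) * (ln t - ln (t - x)) - (x + s) * (ln (x + s) - ln s)).

(** This is [(t + s)^2] times the [t]-derivative of [log_Hbound t x s]. The variable [x] comes last
    because the sign is found by differentiating in [x]. *)
Definition log_Hbound_slope (t s x : R) : R :=
  (t ^ 2 + 2 * s * t - s * x) * (ln t - ln (t - x))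
  - x * (t + s) - s * (x + s) * (ln (x + s) - ln s).

Lemma log_Hbound_slope_nonneg (t s x : R) :
  0 < s -> 0 <= x < t -> 0 <= log_Hbound_slope t s x.
Proof.
  intros Hs Hx.
  replace 0 with (log_Hbound_slope t s 0)
    by (unfold log_Hbound_slope; rewrite Rminus_0_r, Rplus_0_l; ring).
  apply nonneg_derive_le with
    (df := fun z => z * (t + s) / (t - z)
                    - s * ((ln t - ln (t - z)) + (ln (z + s) - ln s)));
    [lra | |].
  - intros z Hz; unfold log_Hbound_slope; auto_derive; [lra |].
    unfold Rminus; field; lra.
  - intros z Hz.
    (* This is [ln y <= y - 1] at [y = t (z + s) / ((t - z) s)]; multiplied by [s], it gives the
       sign of the derivative. *)
    assert (Hy : ln t - ln (t - z) + (ln (z + s) - ln s)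
                 <= (t * (z + s) - (t - z) * s) / ((t - z) * s)).
    { replace (ln t - ln (t - z) + (ln (z + s) - ln s))
        with (ln (t * (z + s)) - ln ((t - z) * s))
        by (rewrite !ln_mult by lra; ring).
      apply ln_sub_le; apply Rmult_lt_0_compat; lra. }
    apply Rmult_le_compat_l with (r := s) in Hy; [|lra].
    replace (s * ((t * (z + s) - (t - z) * s) / ((t - z) * s)))
      with (z * (t + s) / (t - z)) in Hy by (field; lra).
    lra.
Qed.

Lemma log_Hbound_increasing (a b x s : R) :
  0 < s -> 0 <= x < a -> a <= b -> log_Hbound a x s <= log_Hbound b x s.
Proof.
  intros Hs Hx Hab.
  apply (nonneg_derive_le (fun t => log_Hbound t x s)
           (fun t => log_Hbound_slope t s x / (t + s) ^ 2)); [lra | |].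
  - intros t Ht; unfold log_Hbound, log_Hbound_slope; auto_derive;
      [repeat split; lra | unfold Rminus; field; lra].
  - intros t Ht; apply Rdiv_le_0_compat.
    + apply log_Hbound_slope_nonneg; lra.
    + apply pow_lt; lra.
Qed.

(** The derivative in [t] blows up at [t = x], so the first unit step is compared directly: the
    difference has the sign of [(x + 1) ln (x + 1) - s ln ((x + s) / s)], and [x] separates the two
    terms. *)
Lemma log_Hbound_endpoint (x s : R) :
  0 < s -> 0 < x -> log_Hbound x x s <= log_Hbound (x + 1) x s.
Proof.
  intros Hs Hx.
  assert (H1 : ln (x + s) - ln s <= x / s).
  { eapply Rle_trans; [apply ln_sub_le; lra | right; field; lra]. }
  assert (H2 : ln 1 - ln (x + 1) <= (1 - (x + 1)) / (x + 1))
    by (apply ln_sub_le; lra).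
  rewrite ln_1 in H2.
  apply Rmult_le_compat_l with (r := s) in H1; [|lra].
  apply Rmult_le_compat_l with (r := x + 1) in H2; [|lra].
  replace (s * (x / s)) with x in H1 by (field; lra).
  replace ((x + 1) * ((1 - (x + 1)) / (x + 1))) with (- x) in H2 by (field; lra).
  apply Rminus_le_0; unfold log_Hbound.
  replace (x + 1 - x) with 1 by ring.
  rewrite ln_1.
  match goal with |- 0 <= ?e =>
    replace e with (((x + 1) * ln (x + 1) - s * (ln (x + s) - ln s)) / (x + 1 + s))
      by (field; lra)
  end.
  apply Rdiv_le_0_compat; lra.
Qed.

(** * Exponential form and monotonicity of [H_n] *)

Lemma Hbound_eq_exp (n : nat) (x v : R) :
  (1 <= n)%nat -> 0 <= x <= INR n -> 0 < v ->
  Hbound n x v = exp (log_Hbound (INR n) x (v ^ 2)).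
Proof.
  intros Hn Hx Hv.
  assert (Hs : 0 < v ^ 2) by (apply pow_lt; lra).
  assert (HN : 0 < INR n) by (apply lt_0_INR; lia).
  unfold Hbound, log_Hbound, Rpower.
  destruct (Rle_dec x (INR n)) as [_ | C]; [|lra].
  rewrite Rmult_1_r, <- exp_plus, ln_exp, (ln_div (v ^ 2)) by lra.
  do 2 f_equal.
  (* At [x = n] every logarithm of a degenerate argument is multiplied by [n - x = 0], so its
     default value is harmless. *)
  destruct (Req_dec x (INR n)) as [-> | Hne].
  - ring.
  - rewrite ln_div by lra; ring.
Qed.

Lemma Hbound_outside (n : nat) (x v : R) : INR n < x -> Hbound n x v = 0.
Proof.
  intros Hx; unfold Hbound.
  destruct (Rle_dec x (INR n)); [lra | ring].
Qed.

Lemma Hbound_nonneg (n : nat) (x v : R) : 0 <= Hbound n x v.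
Proof.
  unfold Hbound; apply Rmult_le_pos.
  - left; apply exp_pos.
  - destruct (Rle_dec x (INR n)); lra.
Qed.

Lemma exp_monotone (a b : R) : a <= b -> exp a <= exp b.
Proof.
  intros [H | ->]; [left; now apply exp_increasing | right; reflexivity].
Qed.

Lemma Hbound_increasing (n : nat) (x v : R) :
  (1 <= n)%nat -> 0 <= x -> 0 < v -> Hbound n x v <= Hbound (S n) x v.
Proof.
  intros Hn Hx Hv.
  assert (Hs : 0 < v ^ 2) by (apply pow_lt; lra).
  assert (HN : 0 < INR n) by (apply lt_0_INR; lia).
  destruct (Rlt_le_dec (INR n) x) as [Hlt | Hle].
  { rewrite Hbound_outside by exact Hlt; apply Hbound_nonneg. }
  assert (HS := S_INR n).
  rewrite !Hbound_eq_exp by (lia || lra).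
  apply exp_monotone; rewrite HS.
  destruct Hle as [Hlt | ->].
  - apply log_Hbound_increasing; lra.
  - now apply log_Hbound_endpoint.
Qed.

(** * Convergence of [H_n] to [F] *)

Lemma Fbound_eq_exp (x v : R) : 0 <= x -> 0 < v ->
  Fbound x v = exp (x - (x + v ^ 2) * (ln (x + v ^ 2) - ln (v ^ 2))).
Proof.
  intros Hx Hv.
  assert (Hs : 0 < v ^ 2) by (apply pow_lt; lra).
  unfold Fbound, Rpower; rewrite <- exp_plus, ln_div by lra.
  f_equal; ring.
Qed.

Lemma is_lim_seq_const_div_INR (c d : R) :
  is_lim_seq (fun n => c / (INR n + d)) 0.
Proof.
  replace (Finite 0) with (Rbar_mult c (Rbar_inv p_infty))
    by (simpl; f_equal; ring).
  apply is_lim_seq_scal_l, is_lim_seq_inv; [|discriminate].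
  eapply is_lim_seq_plus;
    [apply is_lim_seq_INR | apply is_lim_seq_const | reflexivity].
Qed.

(** Using [ln_sub_le] in both orders squeezes the term between [x - x^2 / n] and [x]. The [+ 0] in
    the lower bound matches the form of [is_lim_seq_const_div_INR]. *)
Lemma is_lim_seq_ln_term (x : R) : 0 <= x ->
  is_lim_seq (fun n => (INR n - x) * (ln (INR n) - ln (INR n - x))) x.
Proof.
  intros Hx.
  destruct (nfloor_ex x Hx) as [k Hk].
  apply is_lim_seq_le_le_loc
    with (u := fun n => x - x ^ 2 / (INR n + 0)) (w := fun _ => x).
  (* Since [k] is the integer part of [x], every [n >= S k] exceeds [x]. *)
  - exists (S k); intros n Hn.
    apply le_INR in Hn; rewrite S_INR in Hn.
    assert (H1 : ln (INR n) - ln (INR n - x) <= (INR n - (INR n - x)) / (INR n - x))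
      by (apply ln_sub_le; lra).
    assert (H2 : ln (INR n - x) - ln (INR n) <= (INR n - x - INR n) / INR n)
      by (apply ln_sub_le; lra).
    apply Rmult_le_compat_l with (r := INR n - x) in H1; [|lra].
    apply Rmult_le_compat_l with (r := INR n - x) in H2; [|lra].
    replace ((INR n - x) * ((INR n - (INR n - x)) / (INR n - x)))
      with x in H1 by (field; lra).
    replace ((INR n - x) * ((INR n - x - INR n) / INR n))
      with (- (x - x ^ 2 / (INR n + 0))) in H2 by (field; lra).
    lra.
  - replace (Finite x) with (Finite (x - 0)) by (f_equal; ring).
    apply is_lim_seq_minus';
      [apply is_lim_seq_const | apply is_lim_seq_const_div_INR].
  - apply is_lim_seq_const.
Qed.

Lemma is_lim_seq_Hbound (x v : R) : 0 <= x -> 0 < v ->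
  is_lim_seq (fun n => Hbound n x v) (Fbound x v).
Proof.
  intros Hx Hv.
  assert (Hs : 0 < v ^ 2) by (apply pow_lt; lra).
  rewrite Fbound_eq_exp by assumption.
  destruct (nfloor_ex x Hx) as [k Hk].
  apply is_lim_seq_ext_loc
    with (u := fun n => exp (log_Hbound (INR n) x (v ^ 2))).
  { exists (S k); intros n Hn; symmetry; apply Hbound_eq_exp; [lia | | exact Hv].
    apply le_INR in Hn; rewrite S_INR in Hn; lra. }
  apply is_lim_seq_continuous with (f := exp).
  { apply derivable_continuous_pt, derivable_pt_exp. }
  unfold log_Hbound.
  (* The factor [1 - 0] is the limit of [n / (n + v^2) = 1 - v^2 / (n + v^2)]. *)
  match goal with |- is_lim_seq _ (Finite ?l) =>
    replace l with ((1 - 0) * l) by ring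
  end.
  apply is_lim_seq_mult'.
  - apply is_lim_seq_ext with (u := fun n => 1 - v ^ 2 / (INR n + v ^ 2)).
    { intros n; generalize (pos_INR n); intros; field; lra. }
    apply is_lim_seq_minus';
      [apply is_lim_seq_const | apply is_lim_seq_const_div_INR].
  - apply is_lim_seq_minus'; [|apply is_lim_seq_const].
    now apply is_lim_seq_ln_term.
Qed.

(** An increasing sequence stays below its limit. The shift by [n] keeps all indices at least 1,
    where monotonicity is available. *)
Lemma Hbound_le_Fbound (n : nat) (x v : R) :
  (1 <= n)%nat -> 0 <= x -> 0 < v -> Hbound n x v <= Fbound x v.
Proof.
  intros Hn Hx Hv.
  apply (is_lim_seq_incr_compare (fun k => Hbound (k + n) x v) (Fbound x v))
    with (n := 0%nat).
  - apply -> (is_lim_seq_incr_n (fun k => Hbound k x v) n).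
    now apply is_lim_seq_Hbound.
  - intros k; apply Hbound_increasing; [lia | lra | lra].
Qed.

(** * The bounds [B_1] and [B_2] *)

Lemma ln_quadratic_lower (r : R) : 1 <= r -> 3 - 3 / r <= ln ((3 * r ^ 2 - 1) / 2).
Proof.
  intros Hr; apply Rminus_le_0.
  replace 0 with (ln ((3 * 1 ^ 2 - 1) / 2) - (3 - 3 / 1)).
  2: { replace ((3 * 1 ^ 2 - 1) / 2) with 1 by field; rewrite ln_1; field. }
  (* The numerator is [3 (2 z^3 - 3 z^2 + 1)], factored at its double root [z = 1]. *)
  apply (nonneg_derive_le (fun z => ln ((3 * z ^ 2 - 1) / 2) - (3 - 3 / z))
           (fun z => 3 * (z - 1) ^ 2 * (2 * z + 1) / ((3 * z ^ 2 - 1) * z ^ 2)));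
    [lra | |].
  - intros z Hz; auto_derive; [split; nra | unfold Rminus; field; split; nra].
  - intros z Hz; apply Rdiv_le_0_compat.
    + apply Rmult_le_pos; [nra | lra].
    + apply Rmult_lt_0_compat; nra.
Qed.

(** With [w = (3 r^2 - 1) / 2], the right side is [w ln w - w + 1]; at [w = (x + s) / s] the two
    sides are [- ln B_1 / s] and [- ln F / s]. They agree at [r = 1], and their difference has
    derivative [3 r] times the gap in [ln_quadratic_lower]. *)
Lemma entropy_quadratic_lower (r : R) : 1 <= r ->
  9 / 2 * (r - 1) ^ 2
  <= (3 * r ^ 2 - 1) / 2 * ln ((3 * r ^ 2 - 1) / 2) - 3 / 2 * (r ^ 2 - 1).
Proof.
  intros Hr; apply Rminus_le_0.
  pose (k := fun z => (3 * z ^ 2 - 1) / 2 * ln ((3 * z ^ 2 - 1) / 2)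
                      - 3 / 2 * (z ^ 2 - 1) - 9 / 2 * (z - 1) ^ 2).
  change (0 <= k r).
  replace 0 with (k 1).
  2: { unfold k; replace ((3 * 1 ^ 2 - 1) / 2) with 1 by field; rewrite ln_1; ring. }
  apply nonneg_derive_le
    with (df := fun z => 3 * z * (ln ((3 * z ^ 2 - 1) / 2) - (3 - 3 / z)));
    [lra | |]; intros z Hz.
  - unfold k; auto_derive; [nra | unfold Rminus, Rdiv; simpl pow; field; split; nra].
  - generalize (ln_quadratic_lower z (proj1 Hz)); intros H.
    apply Rmult_le_pos; lra.
Qed.

Lemma Fbound_le_Bound1 (x v : R) : 0 <= x -> 0 < v -> Fbound x v <= Bound1 x v.
Proof.
  intros Hx Hv; rewrite Fbound_eq_exp by assumption; unfold Bound1.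
  assert (Hs : 0 < v ^ 2) by (apply pow_lt; lra).
  apply exp_monotone.
  set (s := v ^ 2) in *.
  set (r := sqrt (1 + 2 * x / (3 * s))).
  assert (Hq : 0 <= 2 * x / (3 * s)) by (apply Rdiv_le_0_compat; lra).
  assert (Hr2 : r ^ 2 = 1 + 2 * x / (3 * s)) by (apply pow2_sqrt; lra).
  assert (Hr : 1 <= r) by (rewrite <- sqrt_1; apply sqrt_le_1_alt; lra).
  assert (Hxr : x = 3 / 2 * s * (r ^ 2 - 1)) by (rewrite Hr2; field; lra).
  rewrite <- ln_div by lra.
  replace ((x + s) / s) with ((3 * r ^ 2 - 1) / 2) by (rewrite Hxr; field; lra).
  replace (x ^ 2 / (s * (1 + r) + 1 / 3 * x)) with (s * (9 / 2 * (r - 1) ^ 2)).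
  (* In terms of [r] the denominator is a multiple of [(r + 1)^2], which cancels against
     [x^2 = 9/4 s^2 (r - 1)^2 (r + 1)^2]. *)
  2: { replace (s * (1 + r) + 1 / 3 * x) with (s * (r + 1) ^ 2 / 2)
         by (rewrite Hxr; field).
       rewrite Hxr; field; lra. }
  replace (x + s) with (s * ((3 * r ^ 2 - 1) / 2)) by (rewrite Hxr; field).
  generalize (entropy_quadratic_lower r Hr); intros H.
  apply Rmult_le_compat_l with (r := s) in H; lra.
Qed.

(** The bound [sqrt (1 + 2 u) <= 1 + u] at [u = x / (3 s)] turns the first denominator into the
    second. *)
Lemma Bound1_le_Bound2 (x v : R) : 0 <= x -> 0 < v -> Bound1 x v <= Bound2 x v.
Proof.
  intros Hx Hv; unfold Bound1, Bound2.
  assert (Hs : 0 < v ^ 2) by (apply pow_lt; lra).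
  apply exp_monotone, Ropp_le_contravar.
  set (s := v ^ 2) in *.
  assert (Hu : 0 <= x / (3 * s)) by (apply Rdiv_le_0_compat; lra).
  assert (Hr : sqrt (1 + 2 * x / (3 * s)) <= 1 + x / (3 * s)).
  { rewrite <- (sqrt_pow2 (1 + x / (3 * s))) by lra.
    apply sqrt_le_1_alt.
    replace (2 * x / (3 * s)) with (2 * (x / (3 * s))) by (field; lra).
    nra. }
  apply Rmult_le_compat_l with (r := s) in Hr; [|lra].
  replace (s * (1 + x / (3 * s))) with (s + 1 / 3 * x) in Hr by (field; lra).
  assert (H0 := sqrt_pos (1 + 2 * x / (3 * s))).
  apply Rmult_le_compat_l; [apply pow2_ge_0|].
  apply Rinv_le_contravar; nra.
Qed.

Theorem mainTheorem2 :
  (forall (n : nat) (x v : R), (1 <= n)%nat -> 0 <= x -> 0 < v ->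
     Hbound n x v <= Fbound x v /\ Fbound x v <= Bound1 x v /\ Bound1 x v <= Bound2 x v) /\
  (forall x v : R, 0 < x -> 0 < v ->
     (forall n : nat, (1 <= n)%nat -> Hbound n x v <= Hbound (S n) x v) /\
     is_lim_seq (fun n : nat => Hbound n x v) (Fbound x v)).
Proof.
  split.
  - intros n x v Hn Hx Hv; split; [|split].
    + now apply Hbound_le_Fbound.
    + now apply Fbound_le_Bound1.
    + now apply Bound1_le_Bound2.
  - intros x v Hx Hv; split.
    + intros n Hn; apply Hbound_increasing; [exact Hn | lra | exact Hv].
    + apply is_lim_seq_Hbound; lra.
Qed.
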